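(* Let $k\ge 1$ and let $r\ge 2$ be even. Then for any $r$-uniform cgh $H$ on $\Omega_n$, \[ |S_k(H)| \ge r|H| - (r-1)(k-1)|\partial H|. \]
   Context: $\Omega_n$ is a set of $n$ points in strictly convex position in the plane with cyclic (clockwise) ordering $\prec$. An $r$-uniform cgh on $\Omega_n$ is a set $H$ of $r$-subsets of $\Omega_n$; $|H|$ is its number of edges and $\partial H=\{e\setminus\{x\}: x\in e\in H\}$ its shadow. Segments of $\Omega_n$ are sets of cyclically consecutive points, each linearly ordered clockwise; disjoint segments satisfy $I_0 \prec \dots \prec I_{r-1}$ if they appear in this order going once around clockwise. For even $r$, a $k$-zigzag in $H$ is a sequence of distinct points $v_0,\dots,v_{k+r-2}$ with $\{v_i,\dots,v_{i+r-1}\}\in H$ for $0\le i<k$, for which there are disjoint segments $I_0 \prec \dots \prec I_{r-1}$ with $\{v_i : i\equiv j \pmod r\}\subseteq I_j$, such that for even $j$: $v_j \prec v_{j+r} \prec \cdots$ in $I_j$, and for odd $j$: $v_j \succ v_{j+r}\succ \cdots$ in $I_j$. The end of such a $k$-zigzag is the $r$-tuple $(v_{k-1},v_k,\dots,v_{k+r-2})$, and $S_k(H)$ is the set of all ends of $k$-zigzags in $H$. *)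

(* Defs.v *)
From mathcomp Require Import all_boot all_order all_algebra.

Set Implicit Arguments.
Unset Strict Implicit.
Unset Printing Implicit Defensive.

(* The points of Omega_n are labelled clockwise by 'I_n; only their cyclic    *)
(* order matters.                                                             *)

Section Cgh.

Variable n : nat.

(* Number of clockwise steps from c to x. *)
Definition cw_dist (c x : 'I_n) : nat := (x + n - c) %% n.

Definition uniform (r : nat) (H : {set {set 'I_n}}) : Prop :=
  forall e, e \in H -> #|e| = r.

Definition shadow (H : {set {set 'I_n}}) : {set {set 'I_n}} :=
  [set e :\ x | e in H, x in e].

(* (a, l) stands for the l consecutive points that start at a, clockwise.     *)
Definition segment : Type := ('I_n * 'I_n.+1)%type.

Definition seg_set (I : segment) : {set 'I_n} :=
  [set x | cw_dist I.1 x < I.2].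

Definition seg_lt (I : segment) (x y : 'I_n) : bool :=
  [&& x \in seg_set I, y \in seg_set I & cw_dist I.1 x < cw_dist I.1 y].

Definition segs_disjoint (r : nat) (I : {ffun 'I_r -> segment}) : bool :=
  [forall i, forall j, (i != j) ==> [disjoint seg_set (I i) & seg_set (I j)]].

(* I_0, ..., I_(r-1) are met in this order on one clockwise turn from some c. *)
Definition segs_cyclic (r : nat) (I : {ffun 'I_r -> segment}) : bool :=
  [exists c : 'I_n, forall i : 'I_r, forall j : 'I_r, (i < j) ==>
    [forall x in seg_set (I i), forall y in seg_set (I j),
       cw_dist c x < cw_dist c y]].

Definition zigzag (r k : nat) (H : {set {set 'I_n}})
    (v : (k + r - 1).-tuple 'I_n) : bool :=
  [&& uniq v,
      [forall i : 'I_k, [set x in take r (drop i v)] \in H] &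
      [exists I : {ffun 'I_r -> segment},
        [&& segs_disjoint I,
            segs_cyclic I,
            [forall j : 'I_r, forall i : 'I_(k + r - 1),
               (i %% r == j) ==> (tnth v i \in seg_set (I j))] &
            [forall j : 'I_r, forall i : 'I_(k + r - 1),
               forall i' : 'I_(k + r - 1),
               ((i %% r == j) && (i' == i + r :> nat)) ==>
               (if odd j then seg_lt (I j) (tnth v i') (tnth v i)
                else seg_lt (I j) (tnth v i) (tnth v i'))]]]].

Definition zigzag_ends (r k : nat) (H : {set {set 'I_n}}) :
    {set r.-tuple 'I_n} :=
  [set t : r.-tuple 'I_n | [exists v : (k + r - 1).-tuple 'I_n,
     zigzag H v && (val t == drop (k - 1) v)]].

End Cgh.

(* Main.v *)
(* Whether an end (x, u_1, ..., u_(r-1)) of a k-zigzag can be prolonged by a  *)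
(* point w depends on the end and the parity of k only: w must complete       *)
(* u_1, ..., u_(r-1) to an edge and lie strictly between x and u_1 (k odd) or *)
(* between u_(r-1) and x (k even).  Hence, among the ends of k-zigzags with a *)
(* common tail u, the first entry of every end except the one with the widest *)
(* arc prolongs the end with the widest arc, which gives the end              *)
(* (u_1, ..., u_(r-1), w) of a (k+1)-zigzag.  So at most one end is lost per  *)
(* tail; a tail is a shadow edge listed clockwise from one of its r-1 points, *)
(* so |S_(k+1)| >= |S_k| - (r-1)|shadow H|, while |S_1| = r|H|.               *)

Require Import Defs.
From mathcomp Require Import all_boot all_order all_algebra.
From mathcomp Require Import zify.

Set Implicit Arguments.
Unset Strict Implicit.
Unset Printing Implicit Defensive.

(** Because even classes run clockwise and odd classes anticlockwise, prolonging a zigzag requires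
    comparing the new point with two points of its end only ([fz_extend]). If [w :: u] and [x :: u]
    are both ends, then [w] and [x] both complete [u] to an edge, and the arcs joining them to a
    fixed extremity of [u] are nested. The point of the narrower arc, say [w], therefore prolongs
    the zigzag ending in [x :: u], and [rcons u w] is an end one step later ([framed_end_step]).
    This move rotates [w :: u], so it is injective, and only the widest end of each tail is lost
    ([framed_ends_step]). There are at most (r-1)|shadow H| tails, and one starts from r|H|
    clockwise listings of edges ([framed_ends0]).

    Only a lower bound is wanted, so it suffices to exhibit enough ends: zigzags are grown in framed
    form, and [fz_zigzag] supplies the segments afterwards. *)

Lemma modnD_small (r a d : nat) : d < r ->
  (a + d) %% r = if a %% r + d < r then a %% r + d else a %% r + d - r.
Proof.
move=> dr; rewrite -modnDml; have ar : a %% r < r by exact: ltn_pmod (leq_trans _ dr).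
case: ltnP => h; first by rewrite modn_small.
have -> : a %% r + d = (a %% r + d - r) + r by lia.
by rewrite modnDr modn_small ?addnK //; lia.
Qed.

(** * Cyclic order by clockwise distance from a base point *)

Section CyclicDistance.

Variable n : nat.
Implicit Types a b c d x y z : 'I_n.

Lemma cw_distE c x : cw_dist c x = if c <= x then x - c else x + n - c.
Proof.
have xn := ltn_ord x; have cn := ltn_ord c; rewrite /cw_dist.
case: leqP => h; last by rewrite modn_small //; lia.
have -> : x + n - c = (x - c) + n by lia.
by rewrite modnDr modn_small //; lia.
Qed.

Lemma ltn_cw_dist c x : cw_dist c x < n.
Proof. have xn := ltn_ord x; rewrite cw_distE; case: ifP; lia. Qed.

(** Change of base point: it turns statements about cyclic order into linear inequalities between
    distances from one [c]. *)
Lemma cw_dist_frame c a b : cw_dist a b =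
  if cw_dist c a <= cw_dist c b then cw_dist c b - cw_dist c a
  else cw_dist c b + n - cw_dist c a.
Proof.
have an := ltn_ord a; have bn := ltn_ord b; have cn := ltn_ord c.
rewrite !cw_distE; do 4?[case: ifP]; lia.
Qed.

Lemma cw_distxx c : cw_dist c c = 0.
Proof. by rewrite cw_distE leqnn subnn. Qed.

Lemma cw_dist_injr c : injective (cw_dist c).
Proof.
move=> x y; have xn := ltn_ord x; have yn := ltn_ord y; have cn := ltn_ord c.
by rewrite !cw_distE => eq_d; apply: val_inj => /=; move: eq_d; do 2?[case: ifP]; lia.
Qed.

Lemma cw_dist_injl c : injective (fun x => cw_dist x c).
Proof.
move=> x y; have xn := ltn_ord x; have yn := ltn_ord y; have cn := ltn_ord c.
by rewrite !cw_distE => eq_d; apply: val_inj => /=; move: eq_d; do 2?[case: ifP]; lia.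
Qed.

Definition cw_lt c x y : bool := cw_dist c x < cw_dist c y.

Lemma cw_lt_sorted_eq c (s1 s2 : seq 'I_n) :
  sorted (cw_lt c) s1 -> sorted (cw_lt c) s2 -> s1 =i s2 -> s1 = s2.
Proof.
apply: irr_sorted_eq => [y x z|x]; first exact: ltn_trans.
exact: ltnn.
Qed.

(** The hypothesis lists the three rotations in which a clockwise triple [a], [b], [d] can be met
    from [c]; [a = b] is allowed. *)
Lemma cw_lt_frame c a b d :
  [|| cw_dist c a <= cw_dist c b < cw_dist c d,
      cw_dist c b < cw_dist c d < cw_dist c a
    | cw_dist c d < cw_dist c a <= cw_dist c b] ->
  cw_lt a b d.
Proof.
have an := ltn_cw_dist c a; have bn := ltn_cw_dist c b.
rewrite /cw_lt (cw_dist_frame c a b) (cw_dist_frame c a d).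
do 2![case: ifP]; lia.
Qed.

Lemma exists_segment c x y : cw_dist c x <= cw_dist c y ->
  exists I : segment n,
    (forall z, (z \in seg_set I) = (cw_dist c x <= cw_dist c z <= cw_dist c y))
    /\ (forall z, z \in seg_set I -> cw_dist I.1 z = cw_dist c z - cw_dist c x).
Proof.
move=> le_xy; have yn := ltn_cw_dist c y.
have ln : (cw_dist c y - cw_dist c x).+1 < n.+1 by lia.
have segE z : (z \in seg_set (x, Ordinal ln)) =
    (cw_dist c x <= cw_dist c z <= cw_dist c y).
  have zn := ltn_cw_dist c z; rewrite inE /= (cw_dist_frame c).
  by case: (leqP (cw_dist c x) (cw_dist c z)) => /=; lia.
exists (x, Ordinal ln); split=> // z; rewrite segE /= => /andP[h _].
by rewrite (cw_dist_frame c) h.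
Qed.

End CyclicDistance.

(** * Framed zigzags: order, prolongation, and recovery of the segments *)

Section Zigzags.

Variables (n m : nat) (H : {set {set 'I_n}}).
Hypothesis m_odd : odd m.
Hypothesis H_unif : uniform m.+1 H.

Let r := m.+1.

(* A (k+1)-zigzag v 0, ..., v (k+m), described by the clockwise distances of  *)
(* its points from a base point c instead of by segments.                     *)
Record framed_zigzag (k : nat) (c : 'I_n) (v : nat -> 'I_n) : Prop := FramedZigzag {
  fz_edge : forall i, i <= k -> [set x in map v (iota i r)] \in H;
  fz_class : forall i j, i <= k + m -> j <= k + m -> i %% r < j %% r ->
    cw_lt c (v i) (v j);
  fz_step : forall i, i + r <= k + m ->
    if odd i then cw_lt c (v (i + r)) (v i) else cw_lt c (v i) (v (i + r))
}.

Definition framed_end (k : nat) (t : seq 'I_n) : Prop :=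
  exists c v, framed_zigzag k c v /\ t = map v (iota k r).

Lemma odd_mod_r i : odd (i %% r) = odd i.
Proof. by apply: odd_mod; rewrite /r /= m_odd. Qed.

Section Framed.

Variables (k : nat) (c : 'I_n) (v : nat -> 'I_n).
Hypothesis fz : framed_zigzag k c v.

(** Steps of length [r] compose, since [r] is even and the parity of the index, hence the direction,
    never changes. *)
Lemma fz_mono i j : i < j -> j <= k + m -> i %% r = j %% r ->
  if odd i then cw_lt c (v j) (v i) else cw_lt c (v i) (v j).
Proof.
move=> ltij jk eqij.
have /dvdnP[d def_d] : r %| j - i by rewrite -eqn_mod_dvd ?eqij //; lia.
have {def_d} def_j : j = i + d * r by lia.
move: ltij jk; rewrite {}def_j {eqij}; case: d => [|d]; [by lia|move=> _].
elim: d => [|d IH] hd; first by rewrite mul1n in hd *; exact: (fz_step fz).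
have hd' : i + d.+1 * r <= k + m by lia.
have {IH} := IH hd'; have := @fz_step _ _ _ fz (i + d.+1 * r).
have -> : i + d.+1 * r + r = i + d.+2 * r by lia.
have -> : odd (i + d.+1 * r) = odd i.
  by rewrite oddD oddM [odd r]/= m_odd andbF addbF.
by move=> /(_ hd); rewrite /cw_lt; case: (odd i); lia.
Qed.

Lemma fz_inj i j : i <= k + m -> j <= k + m -> v i = v j -> i = j.
Proof.
wlog ltij : i j / i < j => [wl ik jk eqv|ik jk eqv].
  by case: (ltngtP i j) => // h; [exact: wl|apply/esym/wl].
case: (ltngtP (i %% r) (j %% r)) => h.
- by have := fz_class fz ik jk h; rewrite eqv /cw_lt ltnn.
- by have := fz_class fz jk ik h; rewrite eqv /cw_lt ltnn.
- by have := fz_mono ltij jk h; rewrite eqv /cw_lt ltnn; case: ifP.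
Qed.

Lemma fz_uniq i l : i + l <= k + m.+1 -> uniq (map v (iota i l)).
Proof.
move=> hl; rewrite map_inj_in_uniq ?iota_uniq // => a b.
by rewrite !mem_iota => ha hb; apply: fz_inj; lia.
Qed.

(** At most [r] consecutive indices have distinct residues, which wrap past [r] at most once. The
    wrapped points precede [v a] as seen from [c], hence follow all the others as seen from
    [v a]. *)
Lemma fz_sorted a l : l <= r -> a + l <= k + m.+1 ->
  sorted (cw_lt (v a)) (map v (iota a l)).
Proof.
move=> lr hl; apply/(sortedP (v a)) => i; rewrite size_map size_iota => il.
rewrite !(nth_map 0) ?size_iota ?nth_iota //; try lia.
have ar : a %% r < r by exact: ltn_pmod.
have le_ai : a %% r <= (a + i) %% r -> cw_dist c (v a) <= cw_dist c (v (a + i)).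
  case: i il => [|i] il; first by rewrite addn0.
  rewrite leq_eqVlt => /orP[/eqP eq_ai|lt_ai]; last first.
    by apply: ltnW; apply: (fz_class fz); lia.
  by move: eq_ai; rewrite modnD_small; [case: ifP|]; lia.
move: le_ai; rewrite modnD_small; last by lia.
case: ltnP => lt_air le_ai; last first.
  (* The three cases: both indices have wrapped, neither has, or the wrap falls between them. *)
  apply: (@cw_lt_frame _ c); apply/or3P/Or32/andP.
  split; apply: (fz_class fz); rewrite ?modnD_small; try lia.
  - by do 2![case: ifP]; lia.
  - by case: ifP; lia.
case: (ltnP (a %% r + i.+1) r) => lt_ai1r.
  apply: (@cw_lt_frame _ c); apply/or3P/Or31/andP; split; first by apply: le_ai; lia.
  by apply: (fz_class fz); rewrite ?modnD_small; try lia; do 2![case: ifP]; lia.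
apply: (@cw_lt_frame _ c); apply/or3P/Or33/andP; split; last by apply: le_ai; lia.
by apply: (fz_class fz); rewrite ?modnD_small; try lia; case: ifP; lia.
Qed.

(** The new index [k + r] falls in the class of [k]. For odd [k] that class decreases, and the class
    below it increases up to [v (k + m)]; for even [k] it increases, and the class above it
    decreases down to [v k.+1]. These two neighbours bound [w] against all other classes. *)
Lemma fz_extend w :
  (if odd k then cw_dist c (v (k + m)) < cw_dist c w < cw_dist c (v k)
   else cw_dist c (v k) < cw_dist c w < cw_dist c (v k.+1)) ->
  [set x in rcons (map v (iota k.+1 m)) w] \in H ->
  framed_zigzag k.+1 c (fun i => if i == k + r then w else v i).
Proof.
move=> w_btw w_edge; set v' := fun i => _.
have m_gt0 : 0 < m by case: (m) m_odd.
have v'E i l : i + l <= k + r -> map v' (iota i l) = map v (iota i l).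
  move=> hl; apply/eq_in_map => j; rewrite mem_iota /v' => hj.
  by case: eqP => //; lia.
have kr : k %% r < r by exact: ltn_pmod.
have old i : i <= k + m -> v' i = v i by rewrite /v'; case: eqP => //; lia.
have new : v' (k + r) = w by rewrite /v' eqxx.
have before i : i <= k + m -> i %% r < k %% r -> cw_lt c (v i) w.
  move=> ik lt_ik; move: w_btw; case: ifP => k_odd /andP[w1 w2]; last first.
    by apply: ltn_trans w1; apply: (fz_class fz) => //; lia.
  have cl : (k + m) %% r = (k %% r).-1.
    by rewrite modnD_small //; case: ifP; lia.
  case: (ltngtP (i %% r) ((k + m) %% r)) => h; try lia.
    by apply: ltn_trans w1; apply: (fz_class fz).
  case: (ltngtP i (k + m)) => h'; try lia; last by rewrite /cw_lt h'.
  have := fz_mono h' (leqnn _) h.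
  have -> : odd i = false.
    by rewrite -odd_mod_r h odd_mod_r oddD k_odd m_odd.
  by move=> h2; apply: ltn_trans h2 w1.
have after i : i <= k + m -> k %% r < i %% r -> cw_lt c w (v i).
  move=> ik lt_ki; move: w_btw; case: ifP => k_odd /andP[w1 w2].
    by apply: (ltn_trans w2); apply: (fz_class fz) => //; lia.
  have ir : i %% r < r by exact: ltn_pmod.
  have cl : k.+1 %% r = (k %% r).+1.
    by rewrite -addn1 modnD_small //; case: ifP; lia.
  case: (ltngtP (i %% r) (k.+1 %% r)) => h; try lia.
    by apply: (ltn_trans w2); apply: (fz_class fz) => //; lia.
  case: (ltngtP i k.+1) => h'; last by rewrite /cw_lt h'.
    have k1 : k.+1 <= k + m by lia.
    have := fz_mono h' k1 h.
    have -> : odd i by rewrite -odd_mod_r h odd_mod_r /= k_odd.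
    exact: ltn_trans.
  (* Impossible case: fewer than [r] indices separate [i] from [k.+1], so they cannot share a
     residue. *)
  have [d def_i] : exists d, i = k.+1 + d by exists (i - k.+1); lia.
  move: h; rewrite def_i modnD_small; last by lia.
  by case: ifP; lia.
split=> [i ik|i j ik jk lt_ij|i ik].
- case: (ltngtP i k.+1) => hi; try lia.
    by rewrite v'E; [exact: (fz_edge fz)|rewrite /r; lia].
  rewrite hi /r -(addn1 m) iotaD map_cat v'E /=; last by rewrite /r; lia.
  by rewrite addSnnS new cats1.
- case: (ltngtP i (k + r)) => hi; try lia; case: (ltngtP j (k + r)) => hj; try lia.
  + by rewrite !old; try lia; apply: (fz_class fz); lia.
  + rewrite hj new old; last by lia.
    by apply: before; move: lt_ij; rewrite ?hj ?modnDr //; lia.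
  + rewrite hi new old; last by lia.
    by apply: after; move: lt_ij; rewrite ?hi ?modnDr //; lia.
  + by move: lt_ij; rewrite hi hj ltnn.
- case: (ltngtP i k) => hi; try lia.
    by rewrite !old; try lia; apply: (fz_step fz); lia.
  rewrite hi new old; last by lia.
  by move: w_btw; case: (odd k) => /andP[].
Qed.

Lemma fz_zigzag : [exists v' : (k.+1 + r - 1).-tuple 'I_n,
  zigzag (r := r) H v' && (drop k v' == map v (iota k r))].
Proof.
set N := k.+1 + r - 1.
have sz : size (map v (iota 0 N)) == N by rewrite size_map size_iota.
have tE (i : 'I_N) : tnth (Tuple sz) i = v i.
  by rewrite (tnth_nth (v 0)) /= (nth_map 0) ?size_iota // nth_iota.
apply/existsP; exists (Tuple sz); apply/andP; split; last first.
  by rewrite /= -map_drop drop_iota add0n (_ : N - k = r) //; rewrite /N; lia.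
apply/and3P; split.
- by apply: fz_uniq; rewrite /N /r; lia.
- apply/forallP => i /=; rewrite -map_drop -map_take drop_iota take_iota add0n.
  have -> : minn r (N - i) = r by have := ltn_ord i; rewrite /N; lia.
  by apply: (fz_edge fz); have := ltn_ord i; lia.
have seg_of (j : 'I_r) : exists I : segment n,
    [/\ exists a b : 'I_N, [/\ a %% r = j, b %% r = j & forall z, z \in seg_set I ->
        cw_dist c (v a) <= cw_dist c z <= cw_dist c (v b)],
      forall i : 'I_N, i %% r = j -> v i \in seg_set I
    & forall y z, y \in seg_set I -> z \in seg_set I ->
        cw_lt c y z -> seg_lt I y z].
  (* Class [j] contains the index [j], so it has points nearest to and farthest from [c]; the
     segment spans exactly these. *)
  have jN : j < N by have := ltn_ord j; rewrite /N /r; lia.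
  pose i0 := Ordinal jN; pose P (i : 'I_N) := i %% r == j.
  have Pi0 : P i0 by rewrite /P /= modn_small.
  pose p (i : 'I_N) := cw_dist c (v i).
  case: (@arg_minnP _ i0 P p Pi0) => a /eqP Pa mina.
  case: (@arg_maxnP _ i0 P p Pi0) => b /eqP Pb maxb.
  have le_ab : cw_dist c (v a) <= cw_dist c (v b).
    by apply: mina; apply/eqP.
  have [I [memI distI]] := exists_segment le_ab.
  exists I; split.
  + by exists a, b; split=> // z; rewrite memI.
  + move=> i /eqP Pi; rewrite memI; apply/andP.
    by split; [exact: mina|exact: maxb].
  + move=> y z yI zI lt_yz; rewrite /seg_lt yI zI !distI //=.
    by move: lt_yz yI zI; rewrite !memI /cw_lt; lia.
have /fin_all_exists[I HI] := seg_of.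
have IC (i j : 'I_r) : i < j -> forall x y,
    x \in seg_set (I i) -> y \in seg_set (I j) -> cw_lt c x y.
  move=> lt_ij x y; case: (HI i) => -[a [b [_ Pb mem_i]]] _ _.
  case: (HI j) => -[a' [b' [Pa' _ mem_j]]] _ _ /mem_i/andP[_ h1] /mem_j/andP[h2 _].
  apply: leq_ltn_trans h1 _; apply: leq_trans h2.
  apply: (fz_class fz); rewrite ?Pb ?Pa' //.
    by have := ltn_ord b; rewrite /N /r; lia.
  by have := ltn_ord a'; rewrite /N /r; lia.
apply/existsP; exists [ffun j => I j]; apply/and4P; split.
- apply/forallP => i; apply/forallP => j; apply/implyP => ij.
  rewrite !ffunE; apply/pred0P => x /=; apply/negP => /andP[xi xj].
  case: (ltngtP i j) => [lt_ij|lt_ji|/val_inj eq_ij].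
  + by have := IC _ _ lt_ij _ _ xi xj; rewrite /cw_lt ltnn.
  + by have := IC _ _ lt_ji _ _ xj xi; rewrite /cw_lt ltnn.
  + by rewrite eq_ij eqxx in ij.
- apply/existsP; exists c; apply/forallP => i; apply/forallP => j.
  apply/implyP => lt_ij; rewrite !ffunE; apply/forall_inP => x xi.
  by apply/forall_inP => y yj; apply: IC xi yj.
- apply/forallP => j; apply/forallP => i; apply/implyP => /eqP ij.
  by rewrite ffunE tE; case: (HI j) => _ + _; exact.
- apply/forallP => j; apply/forallP => i; apply/forallP => i'.
  apply/implyP => /andP[/eqP ij /eqP i'E]; rewrite !ffunE !tE.
  case: (HI j) => _ memI ltI.
  have vi := memI _ ij.
  have vi' : v i' \in seg_set (I j) by apply: memI; rewrite i'E modnDr.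
  have hi' : i + r <= k + m by have := ltn_ord i'; rewrite i'E /N /r; lia.
  have := fz_step fz hi'; rewrite -i'E -ij odd_mod_r.
  by case: ifP => _ h; apply: ltI.
Qed.

End Framed.

(** * Ends with a common tail and their arcs *)

(* Clockwise length of the arc into which the vertex following the end t of   *)
(* a (k+1)-zigzag must be inserted, when x is the head of t.                  *)
Definition gap (k : nat) (t : seq 'I_n) (x : 'I_n) : nat :=
  if odd k then cw_dist (nth x t m) x else cw_dist x (nth x t 1).

Lemma framed_end_zigzag k (t : r.-tuple 'I_n) :
  framed_end k t -> t \in zigzag_ends r k.+1 H.
Proof.
case=> c [v [fz eq_t]]; rewrite inE.
have /existsP[v' /andP[zv' /eqP ends]] := fz_zigzag fz.
by apply/existsP; exists v'; rewrite zv' (_ : k.+1 - 1 = k) ?subn1 // ends -eq_t /=.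
Qed.

Lemma framed_end_uniq k t : framed_end k t -> uniq t.
Proof. by case=> c [v [fz ->]]; apply: (fz_uniq fz); rewrite /r. Qed.

Lemma framed_end_edge k t : framed_end k t -> [set x in t] \in H.
Proof. by case=> c [v [fz ->]]; apply: (fz_edge fz). Qed.

Lemma framed_end_sorted k x y u :
  framed_end k [:: x, y & u] -> sorted (cw_lt y) (y :: u).
Proof.
case=> c [v [fz [_ eq_u]]].
have yE : y = v k.+1.
  by case: (m) m_odd eq_u => //= m' _ [].
by rewrite eq_u yE; apply: (fz_sorted fz); rewrite /r; lia.
Qed.

Lemma framed_end_step k x w u : framed_end k (w :: u) -> framed_end k (x :: u) ->
  gap k (w :: u) w < gap k (x :: u) x -> framed_end k.+1 (rcons u w).
Proof.
move=> ew [c [v [fz [xE uE]]]] gap_lt.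
have m_gt0 : 0 < m by case: (m) m_odd.
have u_nth i z : i < m -> nth z u i = v (k.+1 + i).
  by move=> im; rewrite uE (nth_map 0) ?size_iota // nth_iota.
have szu : size u = m by rewrite uE size_map size_iota.
exists c, (fun i => if i == k + r then w else v i); split; last first.
  rewrite /r -(addn1 m) iotaD map_cat /= addSnnS addn1 eqxx cats1; congr rcons.
  rewrite uE; apply/eq_in_map => j; rewrite mem_iota => hj.
  by case: eqP => //; rewrite /r; lia.
have wu i : i < m -> w != v (k.+1 + i).
  move=> im; rewrite -(u_nth i w im); have := framed_end_uniq ew.
  by rewrite cons_uniq => /andP[+ _]; apply: contraNneq => {1}->; rewrite mem_nth ?szu.
apply: (fz_extend fz); last first.
  rewrite -uE; have := framed_end_edge ew; congr (_ \in H).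
  by apply/setP => z; rewrite !inE mem_rcons inE.
have pw := ltn_cw_dist c w; have px := ltn_cw_dist c x.
have last_u y z : nth z (y :: u) m = v (k + m).
  have {1}-> : m = m.-1.+1 by lia.
  by rewrite /= u_nth; [congr v|]; lia.
have first_u y z : nth z (y :: u) 1 = v k.+1 by rewrite /= u_nth ?addn0.
have kr : k %% r < r by exact: ltn_pmod.
move: gap_lt; rewrite /gap !last_u !first_u; case k_odd: (odd k).
  have : cw_lt c (v (k + m)) (v k).
    apply: (fz_class fz); try lia.
    by have := odd_mod_r k; rewrite k_odd modnD_small //; case: ifP; lia.
  (* Excludes a gap of zero, so that [w] lies strictly inside the arc. *)
  have : w != v (k + m) by rewrite (_ : k + m = k.+1 + m.-1) ?wu; lia.
  rewrite -(inj_eq (@cw_dist_injr _ c)) 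
          !(cw_dist_frame c (v (k + m))).
  by rewrite -xE /cw_lt; do 2![case: ifP]; lia.
have : cw_lt c (v k) (v k.+1).
  apply: (fz_class fz); try lia.
  by have := odd_mod_r k; rewrite k_odd -[k.+1]addn1 modnD_small //; case: ifP; lia.
have : w != v k.+1 by rewrite -[k.+1]addn0 wu.
have vn := ltn_cw_dist c (v k.+1).
rewrite -(inj_eq (@cw_dist_injr _ c)) (cw_dist_frame c w) (cw_dist_frame c x).
by rewrite -xE /cw_lt; do 2![case: ifP]; lia.
Qed.

Lemma gap_inj k x y u : size u = m ->
  gap k (x :: u) x = gap k (y :: u) y -> x = y.
Proof.
rewrite /gap; case: (m) m_odd => //= m' _ sz_u.
rewrite !(set_nth_default x y) ?sz_u //.
by case: (odd k); [apply: cw_dist_injr|apply: cw_dist_injl].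
Qed.

(** * Counting ends through flags (an edge with one of its points) *)

Lemma card_flags (T : finType) (A : {set {set T}}) (s : nat) :
  (forall e, e \in A -> #|e| = s) ->
  #|[set f : {set T} * T | (f.1 \in A) && (f.2 \in f.1)]| = #|A| * s.
Proof.
move=> cardA; rewrite -sum1dep_card.
rewrite -(pair_big_dep (mem A) (fun e x => x \in e) (fun _ _ => 1)) /=.
by rewrite -sum_nat_const; apply: eq_bigr => e /cardA <-; rewrite sum1_card.
Qed.

Lemma card_shadow_edge e : e \in shadow H -> #|e| = m.
Proof.
case/imset2P=> f x fH xf ->.
by have := cardsD1 x f; rewrite xf H_unif // => -[].
Qed.

Lemma framed_ends0 : exists E : {set r.-tuple 'I_n},
  (forall t : r.-tuple 'I_n, t \in E -> framed_end 0 t) /\ #|H| * r <= #|E|.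
Proof.
pose E := [set t : r.-tuple 'I_n |
  ([set x in t] \in H) && sorted (cw_lt (thead t)) t].
exists E; split=> [t|].
  rewrite inE => /andP[tH t_sorted]; exists (thead t), (nth (thead t) t).
  have tE : [seq nth (thead t) t i | i <- iota 0 r] = t.
    by rewrite -[in iota 0 r](size_tuple t) map_nth_iota0 // take_size.
  split; last by rewrite tE.
  split=> [i|i j|i]; rewrite ?add0n.
  - by rewrite leqn0 => /eqP->; rewrite tE.
  - move=> im jm; rewrite !modn_small // => lt_ij.
    by apply: (sorted_ltn_nth _ _ t_sorted);
      rewrite ?inE ?size_tuple //; move=> y x z; apply: ltn_trans.
  - by rewrite /r; lia.
rewrite -(card_flags H_unif).
(* Every flag [(e, x)] is attained: list [e] clockwise from [x]. *)
apply: leq_trans (leq_imset_card (fun t : r.-tuple 'I_n => ([set x in t], thead t)) E).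
apply/subset_leq_card/subsetP => -[e x]; rewrite inE /= => /andP[eH xe].
pose s := x :: sort (fun y z => cw_dist x y <= cw_dist x z) (enum (e :\ x)).
have mem_s y : (y \in s) = (y \in e).
  rewrite inE mem_sort mem_enum !inE; by case: eqP => [->|].
have sz_s : size s == r.
  by rewrite /= size_sort -cardE; have := cardsD1 x e; rewrite xe H_unif // add1n => <-.
apply/imsetP; exists (Tuple sz_s); last first.
  by congr pair; apply/setP => y; rewrite inE mem_s.
have -> : (Tuple sz_s \in E) = ([set x in s] \in H) && sorted (cw_lt x) s by rewrite inE.
apply/andP; split.
  by rewrite (_ : [set y in s] = e) //; apply/setP => y; rewrite inE mem_s.
rewrite /= path_min_sorted.
  rewrite (eq_sorted (e' := relpre (cw_dist x) ltn)) // -sorted_map ltn_sorted_uniq_leq.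
  rewrite map_inj_uniq ?sort_uniq ?enum_uniq /=; last exact: cw_dist_injr.
  by rewrite sorted_map sort_sorted // => y z; apply: leq_total.
apply/allP => y; rewrite mem_sort mem_enum !inE => /andP[yx _].
rewrite /cw_lt cw_distxx lt0n; apply: contraNneq yx => h.
by apply/eqP/(@cw_dist_injr _ x); rewrite h cw_distxx.
Qed.

Lemma framed_ends_step k (E : {set r.-tuple 'I_n}) :
  (forall t : r.-tuple 'I_n, t \in E -> framed_end k t) ->
  exists E' : {set r.-tuple 'I_n},
    (forall t : r.-tuple 'I_n, t \in E' -> framed_end k.+1 t) /\
    #|E| <= #|E'| + #|shadow H| * m.
Proof.
move=> fE; have m_gt0 : 0 < m by case: (m) m_odd.
(* [far] marks the ends that are not the widest for their tail; these are the ones that can be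
   rotated. *)
pose far (t : r.-tuple 'I_n) := [exists t' in E, (behead t == behead t') &&
  (gap k t (thead t) < gap k t' (thead t'))].
exists [set [tuple of rot 1 (val t)] | t : r.-tuple 'I_n in [set t in E | far t]]; split.
  move=> _ /imsetP[t + ->]; rewrite inE => /andP[tE /exists_inP[t' t'E /andP[/eqP eqb lt_g]]].
  have [ft ft'] := (fE _ tE, fE _ t'E).
  case/tupleP: t tE eqb lt_g ft => w u _; case/tupleP: t' t'E ft' => x u' _.
  rewrite !theadE /= rot1_cons => ft' eq_u lt_g ft.
  by move: ft' lt_g; rewrite -eq_u; exact: framed_end_step.
rewrite card_imset; last by move=> t t' /(congr1 val) /rot_inj /val_inj.
rewrite -(cardsID [set t | far t] E) leq_add //.
  by apply/subset_leq_card/subsetP => t; rewrite !inE andbC.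
rewrite -(card_flags card_shadow_edge).
(* The remaining ends inject into flags of the shadow: the tail as a set, with its first point. *)
pose f (t : r.-tuple 'I_n) := ([set x in behead t], nth (thead t) t 1).
rewrite -(card_in_imset (f := f)).
  apply/subset_leq_card/subsetP => _ /imsetP[t + ->]; rewrite !inE => /andP[_ tE].
  have ft := fE _ tE.
  case/tupleP: t tE ft => x u tE ft; rewrite /f /= theadE.
  rewrite mem_nth ?size_tuple // andbT.
  apply/imset2P; exists [set y in x :: u] x; first exact: framed_end_edge ft.
    by rewrite inE mem_head.
  apply/setP => y; rewrite !inE; case: eqP => //= ->.
  by have := framed_end_uniq ft; rewrite /= => /andP[/negbTE].
move=> t t'; rewrite !inE => /andP[/existsPn nf tE] /andP[/existsPn nf' t'E].
rewrite /f => -[eq_set eq_y].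
have [ft ft'] := (fE _ tE, fE _ t'E).
(* A tail is listed clockwise from its first point, so the flag determines it. *)
have eq_b : behead t = behead t'.
  case/tupleP: t ft eq_set eq_y {nf tE} => x [[|y u] sz_u]; first by rewrite -(eqP sz_u) in m_gt0.
  case/tupleP: t' ft' {nf' t'E} => x' [[|y' u'] sz_u']; first by rewrite -(eqP sz_u') in m_gt0.
  rewrite /= => ft' ft eq_set eq_y; rewrite -{}eq_y in ft' eq_set *.
  apply: (cw_lt_sorted_eq (framed_end_sorted ft) (framed_end_sorted ft')) => z.
  by have /setP/(_ z) := eq_set; rewrite !inE.
(* Both ends are widest for the same tail, so their gaps agree, and the gap determines the head. *)
have eq_g : gap k t (thead t) = gap k t' (thead t').
  have := nf t'; have := nf' t; rewrite tE t'E eq_b eqxx /=; lia.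
case/tupleP: t eq_b eq_g {ft eq_set eq_y nf tE} => x u.
case/tupleP: t' {ft' nf' t'E} => x' u'; rewrite !theadE /= => /val_inj <- eq_g.
by rewrite (gap_inj (size_tuple u) eq_g).
Qed.

Lemma framed_ends k : exists E : {set r.-tuple 'I_n},
  (forall t : r.-tuple 'I_n, t \in E -> framed_end k t) /\
  #|H| * r <= #|E| + k * (#|shadow H| * m).
Proof.
elim: k => [|k [E [fE cardE]]].
  by have [E [fE cardE]] := framed_ends0; exists E; rewrite mul0n addn0.
have [E' [fE' cardE']] := framed_ends_step fE.
exists E'; split=> //; apply: leq_trans cardE _.
by rewrite mulSn addnA leq_add2r.
Qed.

Lemma card_zigzag_ends k :
  #|H| * r <= #|zigzag_ends r k.+1 H| + k * (#|shadow H| * m).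
Proof.
have [E [fE cardE]] := framed_ends k.
apply: leq_trans cardE _; rewrite leq_add2r; apply/subset_leq_card/subsetP => t tE.
exact/framed_end_zigzag/fE.
Qed.

End Zigzags.

(** * The bound over the integers *)

Import Order.TTheory GRing.Theory Num.Theory.
Local Open Scope ring_scope.

Theorem theorem3p1 (n k r : nat) (hk : (1 <= k)%N) (hr : (2 <= r)%N)
    (hr_even : ~~ odd r) (H : {set {set 'I_n}}) (hH : uniform r H) :
  r%:Z * #|H|%:Z - (r%:Z - 1) * (k%:Z - 1) * #|shadow H|%:Z
    <= #|zigzag_ends r k H|%:Z.
Proof.
case: k hk => // k _; case: r hr hr_even H hH => // m hm hm_even H hH.
have m_odd : odd m by rewrite -[odd m]negbK.
have := card_zigzag_ends m_odd hH k; nia.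
Qed.
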